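(* Let $(\mathfrak{g},[-,-],P)$ be a Rota-Baxter Lie algebra of weight zero and $(\mathfrak{g},\circ)$ be the induced pre-Lie algebra, $x\circ y=[P(x),y]$. Let $Q:\mathfrak g\rightarrow \mathfrak g$ be a linear map that is admissible to $(\mathfrak{g},[-,-],P)$. Define linear maps $l_{\mathrm{ad}^*,Q^*},r_{\mathrm{ad}^*,Q^*}:\mathfrak g\to\mathrm{End}(\mathfrak g^* )$ by $l_{\mathrm{ad}^*,Q^*}(x)a^*=\mathrm{ad}^*(P(x))a^*$ and $r_{\mathrm{ad}^*,Q^*}(x)a^*=-\mathrm{ad}^*(x)Q^*(a^* )$. (a) The triple $(\mathfrak{g}^{*},l_{\mathrm{ad}^{*},Q^{*}},r_{\mathrm{ad}^{*},Q^{*}})$ is a representation of the pre-Lie algebra $(\mathfrak{g},\circ)$. (b) Define an operation $\triangleleft:\mathfrak{g}\otimes\mathfrak{g}\rightarrow\mathfrak{g}$ by $x\triangleleft y=-Q([x,y])$ for all $x,y\in\mathfrak g$. Then $l_{\mathrm{ad}^{*},Q^{*}}=\mathcal{L}^{*}_{\circ}$ and $r_{\mathrm{ad}^{*},Q^{*}}=\mathcal{L}^{*}_{\triangleleft}$. (c) With $\triangleleft$ as in (b), define an operation $\triangleright:\mathfrak{g}\otimes\mathfrak{g}\rightarrow\mathfrak{g}$ by $x\triangleright y=x\circ y-x\triangleleft y$. Then $(\mathfrak{g},\triangleright,\triangleleft)$ is a compatible special L-dendriform algebra of the pre-Lie algebra $(\mathfrak g, \circ)$.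
   Context: All vector spaces and algebras are finite-dimensional over a field of characteristic zero. A Rota-Baxter Lie algebra of weight zero is $(\mathfrak{g},[-,-],P)$ with $(\mathfrak g,[-,-])$ a Lie algebra and $P$ linear with $[P(x),P(y)]=P([x,P(y)])+P([P(x),y])$; the operation $x\circ y=[P(x),y]$ is then pre-Lie. $Q$ is admissible to $(\mathfrak g,[-,-],P)$ if $Q([P(x),y])-[P(x),Q(y)]-Q([x,Q(y)])=0$ for all $x,y\in\mathfrak g$. A pre-Lie algebra is $(A,\circ)$ with $(x\circ y)\circ z-x\circ(y\circ z)=(y\circ x)\circ z-y\circ(x\circ z)$. A representation of it is $(V,l,r)$ with $l,r:A\to\mathrm{End}(V)$ linear such that $l(x)l(y)v-l(x\circ y)v=l(y)l(x)v-l(y\circ x)v$ and $l(x)r(y)v-r(y)l(x)v=r(x\circ y)v-r(y)r(x)v$. For linear $\rho:A\to\mathrm{End}(V)$, $\rho^*:A\to\mathrm{End}(V^* )$ is given by $\langle\rho^*(x)v^*,u\rangle=-\langle v^*,\rho(x)u\rangle$; for a linear map $Q:\mathfrak g\to\mathfrak g$, $Q^*$ is the transpose. $\mathrm{ad}(x)y=[x,y]$, $\mathcal L_\circ(x)y=x\circ y$, $\mathcal L_{\triangleleft}(x)y=x\triangleleft y$. An L-dendriform algebra $(A,\triangleright,\triangleleft)$ satisfies $(x\triangleright y)\triangleright z+(x\triangleleft y)\triangleright z+y\triangleright(x\triangleright z)-(y\triangleleft x)\triangleright z-(y\triangleright x)\triangleright z-x\triangleright(y\triangleright z)=0$ and $(x\triangleright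 y)\triangleleft z+y\triangleleft(x\triangleright z)+y\triangleleft(x\triangleleft z)-(y\triangleleft x)\triangleleft z-x\triangleright(y\triangleleft z)=0$; it is special if $\triangleleft$ is antisymmetric. A special L-dendriform algebra is compatible with the pre-Lie algebra $(A,\circ)$ if $x\circ y=x\triangleright y+x\triangleleft y$ for all $x,y$. *)

(* Defs.v *)
From HB Require Import structures.
From mathcomp Require Import all_boot all_order all_algebra.

Set Implicit Arguments.
Unset Strict Implicit.
Unset Printing Implicit Defensive.

Import GRing.Theory.
Local Open Scope ring_scope.

(* A bilinear operation A (x) A -> A is given in curried form, as a linear map
   m : A -> End(A), with m x y the product of x and y.  Hence m is itself the
   left multiplication operator x |-> L_m(x), and a Lie bracket br is itself
   the adjoint map x |-> ad(x). *)
Definition binop (F : fieldType) (A : vectType F) := 'Hom(A, 'End(A)).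

Definition dual (F : fieldType) (V : vectType F) := 'Hom(V, F^o).

Section Dual.
Variables (F : fieldType) (A V : vectType F).

Definition transpose (f : 'End(V)) : 'End(dual V) :=
  linfun (fun a : dual V => (a \o f)%VF).

(* rho^*, with its sign: <rho^*(x) a, u> = - <a, rho(x) u>. *)
Definition dual_map (rho : 'Hom(A, 'End(V))) : 'Hom(A, 'End(dual V)) :=
  linfun (fun x => - transpose (rho x)).

(* The value of linfun on a map is that map only when the map is linear; this
   lemma and the other "E" lemmas check it for the maps used here. *)
Lemma transposeE f (a : dual V) u : (transpose f a) u = a (f u).
Proof.
pose h (b : dual V) := (b \o f)%VF : dual V.
have hl : linear h by move=> k b c; rewrite /h comp_lfunDl -comp_lfunZl.
pose H : {linear dual V -> dual V} :=
  HB.pack h (GRing.isLinear.Build F (dual V) (dual V) _ h hl).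
by rewrite (lfunE H) /= /h comp_lfunE.
Qed.

Lemma dual_mapE rho x (a : dual V) u : (dual_map rho x a) u = - a (rho x u).
Proof.
pose h (x : A) := - transpose (rho x).
have hl : linear h.
  move=> k y z; apply/lfunP => b; apply/lfunP => v.
  rewrite /h !(opp_lfunE, add_lfunE, scale_lfunE, transposeE) linearP /=.
  by rewrite !(add_lfunE, scale_lfunE) linearP opprD -scalerN.
pose H : {linear A -> 'End(dual V)} :=
  HB.pack h (GRing.isLinear.Build F A 'End(dual V) _ h hl).
by rewrite (lfunE H) /= /h !opp_lfunE transposeE.
Qed.

End Dual.

Section Algebras.
Variables (F : fieldType) (A : vectType F).

Definition lie_algebra (br : binop A) : Prop :=
  (forall x, br x x = 0) /\
  (forall x y z, br x (br y z) + br y (br z x) + br z (br x y) = 0).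

Definition rota_baxter_lie (br : binop A) (P : 'End(A)) : Prop :=
  lie_algebra br /\
  (forall x y, br (P x) (P y) = P (br x (P y)) + P (br (P x) y)).

Definition admissible (br : binop A) (P Q : 'End(A)) : Prop :=
  forall x y, Q (br (P x) y) - br (P x) (Q y) - Q (br x (Q y)) = 0.

Definition prelie (m : binop A) : Prop :=
  forall x y z, m (m x y) z - m x (m y z) = m (m y x) z - m y (m x z).

Definition prelie_representation (m : binop A) (V : vectType F)
    (l r : 'Hom(A, 'End(V))) : Prop :=
  [/\ prelie m,
      forall x y v,
        l x (l y v) - l (m x y) v = l y (l x v) - l (m y x) v
    & forall x y v,
        l x (r y v) - r y (l x v) = r (m x y) v - r y (r x v)].

(* The operations written x |> y and x <| y are rt x y and lt x y. *)
Definition l_dendriform (rt lt : binop A) : Prop :=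
  (forall x y z,
     rt (rt x y) z + rt (lt x y) z + rt y (rt x z)
       - rt (lt y x) z - rt (rt y x) z - rt x (rt y z) = 0) /\
  (forall x y z,
     lt (rt x y) z + lt y (rt x z) + lt y (lt x z)
       - lt (lt y x) z - rt x (lt y z) = 0).

Definition special_l_dendriform (rt lt : binop A) : Prop :=
  l_dendriform rt lt /\ (forall x y, lt x y = - lt y x).

Definition compatible_special_l_dendriform (m rt lt : binop A) : Prop :=
  [/\ prelie m, special_l_dendriform rt lt
    & forall x y, m x y = rt x y + lt x y].

End Algebras.

Section Induced.
Variables (F : fieldType) (g : vectType F) (br : binop g) (P Q : 'End(g)).

Definition induced_circ : binop g := (br \o P)%VF.

Definition l_adQ : 'Hom(g, 'End(dual g)) := (dual_map br \o P)%VF.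

Definition r_adQ : 'Hom(g, 'End(dual g)) :=
  linfun (fun x => - (dual_map br x \o transpose Q)%VF).

Definition tri_lt : binop g := linfun (fun x => - (Q \o br x)%VF).

Definition tri_rt : binop g := induced_circ - tri_lt.

Lemma induced_circE x y : induced_circ x y = br (P x) y.
Proof. by rewrite comp_lfunE. Qed.

Lemma l_adQE x a : l_adQ x a = dual_map br (P x) a.
Proof. by rewrite comp_lfunE. Qed.

Lemma r_adQE x a : r_adQ x a = - dual_map br x (transpose Q a).
Proof.
pose h (x : g) := - (dual_map br x \o transpose Q)%VF.
have hl : linear h.
  by move=> k y z; rewrite /h linearP comp_lfunDl -comp_lfunZl opprD -scalerN.
pose H : {linear g -> 'End(dual g)} :=
  HB.pack h (GRing.isLinear.Build F g 'End(dual g) _ h hl).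
by rewrite (lfunE H) /= /h opp_lfunE comp_lfunE.
Qed.

Lemma tri_ltE x y : tri_lt x y = - Q (br x y).
Proof.
pose h (x : g) := - (Q \o br x)%VF.
have hl : linear h.
  by move=> k u v; rewrite /h linearP comp_lfunDr -comp_lfunZr opprD -scalerN.
pose H : {linear g -> 'End(g)} :=
  HB.pack h (GRing.isLinear.Build F g 'End(g) _ h hl).
by rewrite (lfunE H) /= /h opp_lfunE comp_lfunE.
Qed.

Lemma tri_rtE x y : tri_rt x y = induced_circ x y - tri_lt x y.
Proof. by rewrite /tri_rt add_lfunE opp_lfunE add_lfunE opp_lfunE. Qed.

End Induced.

(* Main.v *)
From HB Require Import structures.
Require Import Defs.
From mathcomp Require Import all_boot all_order all_algebra.
From mathcomp Require Import ring.
Import GRing.Theory VectorInternalTheory.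
Local Open Scope ring_scope.

(** Everything rests on one identity relating the two products,
      [x o (y <| z) - x <| (y <| z) = (x o y) <| z + y <| (x o z)],
    which is admissibility of [Q] at [(x, [y, z])] combined with the Jacobi
    identity for [P x, y, z].  Transposed, it is the second representation axiom
    of the pair of dual left multiplications; since [<|] is antisymmetric, it is
    also the second L-dendriform axiom, and together with the pre-Lie identity it
    gives the first one. *)

(** The coordinates in a basis are linear forms, and they separate vectors. *)
Lemma eq_linear_forms (F : fieldType) (V : vectType F) (u v : V) :
  (forall c : {linear V -> F^o}, c u = c v) -> u = v.
Proof.
move=> eq_uv; apply: v2r_inj; apply/rowP => i.
pose h (w : V) : F^o := v2r w 0 i.
have hl : linear h by move=> k a b; rewrite /h linearP !mxE.
exact: (eq_uv (HB.pack h (GRing.isLinear.Build F V F^o _ h hl))).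
Qed.

(* The ring tactic does not handle modules, but it sees through a linear form. *)
Ltac vect_ring := apply: eq_linear_forms => c; ring.

Section LieBracket.
Variables (F : fieldType) (g : vectType F) (br : binop g).
Hypothesis lie_br : lie_algebra br.

Lemma lie_anticomm x y : br x y = - br y x.
Proof.
have [alt _] := lie_br; apply/eqP; rewrite -addr_eq0; apply/eqP.
have := alt (x + y).
by rewrite !linearD /= !add_lfunE !alt add0r addr0 addrC.
Qed.

Lemma lie_derivation x y z : br x (br y z) = br (br x y) z + br y (br x z).
Proof.
have [_ jac] := lie_br; apply/eqP; rewrite -subr_eq0 -(jac x y z); apply/eqP.
rewrite (lie_anticomm z (br x y)) (lie_anticomm z x) linearN /=; vect_ring.
Qed.

End LieBracket.

Section PreLie.
Variables (F : fieldType) (g : vectType F) (circ lt : binop g).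
Hypothesis prelie_circ : prelie circ.
Hypothesis circ_lt : forall x y z,
  circ x (lt y z) - lt x (lt y z) = lt (circ x y) z + lt y (circ x z).

Lemma prelie_dual_representation :
  prelie_representation circ (dual_map circ) (dual_map lt).
Proof.
split=> [//|x y a|x y a].
(* At [u], both sides are values of [a], with composites in reverse order, so an identity in [g]
   suffices. *)
- apply/lfunP => u; rewrite !add_lfunE !opp_lfunE !dual_mapE !opprK.
  rewrite -!(linearD a) /=; congr (a _).
  have /eqP := prelie_circ x y u; rewrite subr_eq => /eqP ->; vect_ring.
- apply/lfunP => u; rewrite !add_lfunE !opp_lfunE !dual_mapE !opprK.
  rewrite -opprD -(linearB a) -(linearD a) -(linearN a) /=; congr (a _).
  have /eqP := circ_lt x y u; rewrite subr_eq => /eqP ->; vect_ring.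
Qed.

Lemma prelie_l_dendriform (rt : binop g) :
  (forall x y, lt x y = - lt y x) ->
  (forall x y, rt x y = circ x y - lt x y) ->
  l_dendriform rt lt.
Proof.
move=> lt_anti rtE; split=> x y z; rewrite !rtE !(linearB circ, linearB lt) /=.
(* The pre-Lie identity settles the terms in [circ] alone; the rest is the difference of [circ_lt]
   at [(x, y, z)] and at [(y, x, z)]. *)
- rewrite !linearB /= !add_lfunE !opp_lfunE.
  have /eqP := prelie_circ x y z; rewrite subr_eq => /eqP ->.
  have /eqP := circ_lt x y z; rewrite subr_eq => /eqP ->.
  have /eqP := circ_lt y x z; rewrite subr_eq => /eqP ->.
  vect_ring.
(* Antisymmetry cancels [lt (lt x y) z] against [lt (lt y x) z]. *)
- rewrite (lt_anti y x) (linearN lt) linearB /= add_lfunE !opp_lfunE.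
  have /eqP := circ_lt x y z; rewrite subr_eq => /eqP ->.
  vect_ring.
Qed.

End PreLie.

Section RotaBaxter.
Variables (F : fieldType) (g : vectType F) (br : binop g) (P Q : 'End(g)).
Hypotheses (rbP : rota_baxter_lie br P) (admQ : admissible br P Q).

Let lie_br : lie_algebra br := proj1 rbP.
Local Notation circ := (induced_circ br P).
Local Notation lt := (tri_lt br Q).

(** Thus [P] maps the commutator of [circ] to the bracket. By Jacobi, left multiplications then
    respect commutators, which is the pre-Lie identity. *)
Lemma rota_baxter_commutator x y :
  br (P x) (P y) = P (br (P x) y) - P (br (P y) x).
Proof.
have [_ ->] := rbP.
by rewrite (lie_anticomm _ _ _ lie_br x) linearN addrC.
Qed.

Lemma prelie_induced_circ : prelie circ.
Proof.
move=> x y z; rewrite !induced_circE.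
rewrite (lie_derivation _ _ _ lie_br (P x)) rota_baxter_commutator.
rewrite linearB /= add_lfunE opp_lfunE; vect_ring.
Qed.

Lemma tri_lt_antisym x y : lt x y = - lt y x.
Proof. by rewrite !tri_ltE (lie_anticomm _ _ _ lie_br) linearN. Qed.

Lemma circ_tri_lt x y z :
  circ x (lt y z) - lt x (lt y z) = lt (circ x y) z + lt y (circ x z).
Proof.
have := admQ x (br y z); rewrite (lie_derivation _ _ _ lie_br (P x)) linearD.
rewrite !tri_ltE !induced_circE /= => adm.
rewrite (linearN (br (P x))) (linearN (br x)) /=.
apply/eqP; rewrite -subr_eq0 -adm; apply/eqP; vect_ring.
Qed.

Lemma l_adQ_dual : l_adQ br P = dual_map circ.
Proof.
apply/lfunP => x; apply/lfunP => a; apply/lfunP => u.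
by rewrite l_adQE !dual_mapE induced_circE.
Qed.

(** Transposition turns [Q] after [br x] into precomposition with [transpose Q]; the sign in
    [tri_lt] matches the one in [r_adQ]. *)
Lemma r_adQ_dual : r_adQ br Q = dual_map lt.
Proof.
apply/lfunP => x; apply/lfunP => a; apply/lfunP => u.
by rewrite r_adQE opp_lfunE !dual_mapE transposeE tri_ltE (linearN a).
Qed.

End RotaBaxter.

Theorem proposition2p18 (F : fieldType) (charF0 : [pchar F] =i pred0)
    (g : vectType F) (br : binop g) (P Q : 'End(g))
    (rbP : rota_baxter_lie br P) (admQ : admissible br P Q) :
  [/\ prelie_representation (induced_circ br P) (l_adQ br P) (r_adQ br Q),
      l_adQ br P = dual_map (induced_circ br P) /\
      r_adQ br Q = dual_map (tri_lt br Q)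
    & compatible_special_l_dendriform
        (induced_circ br P) (tri_rt br P Q) (tri_lt br Q)].
Proof.
have prelie_circ := prelie_induced_circ _ _ _ _ rbP.
have circ_lt := circ_tri_lt _ _ _ _ _ rbP admQ.
have lt_anti := tri_lt_antisym _ _ _ _ Q rbP.
(* Rewriting by (b) first reduces (a) to dual left multiplications and makes (b) reflexive. *)
rewrite l_adQ_dual r_adQ_dual; split; first exact: prelie_dual_representation.
- by [].
- split=> [//||x y]; last by rewrite tri_rtE subrK.
  split=> //; apply: prelie_l_dendriform => // x y; exact: tri_rtE.
Qed.
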